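(* Let $N\ge 1$, let $V=\mathbb{C}^N$ with basis $v_1,\dots,v_N$ be graded by an arbitrary parity function $i\mapsto[i]\in\{0,1\}$, let $q\in\mathbb{C}$ be the deformation parameter, $q\neq 0$, $q\neq\pm1$, and let $S=PR$ be the graded braid matrix of $GL$-type defined in the context. A matrix $A\in\mathrm{End}(V)$ (not assumed even) satisfies the graded reflection equation $SA_2SA_2=A_2SA_2S$ in $\mathrm{End}(V)\otimes\mathrm{End}(V)$ if and only if it has the form $$A=\sum_{i\in I}x_i\,e^i_i+\sum_{j\in Y}y_j\,e^{\sigma(j)}_j,\qquad I=[1,N],$$ where one of the following two holds. (Type 1) $(Y,\sigma)$ is an admissible pair with $$Y=[1,b_-]\cup[b_+,b_++b_--1],\qquad \sigma(i)=b_++b_--i,$$ for some positive integers $b_-,b_+$ subject to $b_-<b_+$ and $b_-+b_+\le N+1$, and, for some $\lambda,\mu\in\mathbb{C}$, $$x_i=\begin{cases}\lambda+\mu,& i\in[1,b_-],\\ \lambda,& i\in(b_-,b_+),\\ 0,& i\in[b_+,N],\end{cases}\qquad y_iy_{\sigma(i)}=-\lambda\mu\neq 0\quad\text{for all } i\in Y.$$ (Type 2) $(Y,\sigma)$ is an admissible pair such that $Y\cap\sigma(Y)=\varnothing$, and, for some $b\in[b_-,b_+)$ and $\lambda\in\mathbb{C}$, $$x_i=\begin{cases}\lambda,& i\in[1,b],\\ 0,& i\in(b,N],\end{cases}\qquad y_i\neq 0\quad\text{for all } i\in Y,$$ where $b_-,b_+$ are the numbers attached to $(Y,\sigma)$ in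 the context.
   Context: All intervals are intervals of integers: $[a,b]=\{k\in\mathbb{Z}: a\le k\le b\}$, and parentheses denote strict inequalities. Matrix units: $e_{ij}=e^i_j\in\mathrm{End}(V)$ acts by $e_{ij}v_k=\delta_{jk}v_i$. The algebra $\mathrm{End}(V)$ is $\mathbb{Z}_2$-graded with $\deg e_{ij}=[i]+[j] \bmod 2$; an element is even if it has degree $0$. The algebra $\mathrm{End}(V)\otimes\mathrm{End}(V)$ here is the graded tensor product, with multiplication on homogeneous elements $(a_1\otimes b_1)(a_2\otimes b_2)=(-1)^{\deg(a_2)\deg(b_1)}a_1a_2\otimes b_1b_2$. For $A\in\mathrm{End}(V)$, $A_2=1\otimes A$. Put $\omega=q-q^{-1}$ and, in the graded tensor product, $$R=\sum_{i,j}q^{(-1)^{[i]}\delta_{ij}}\,e_{ii}\otimes e_{jj}+\omega\sum_{i>j}(-1)^{[j]}e_{ij}\otimes e_{ji},\qquad P=\sum_{i,j}(-1)^{[j]}e_{ij}\otimes e_{ji},\qquad S=PR.$$ An admissible pair $(Y,\sigma)$ consists of an ordered subset $Y\subset I=[1,N]$ and a strictly decreasing map $\sigma\colon Y\to I$ that preserves parity ($[\sigma(i)]=[i]$) and has no fixed points ($\sigma(i)\ne i$). Put $Y_+=\{i\in Y: i>\sigma(i)\}$, $Y_-=\{i\in Y: i<\sigma(i)\}$, $b_-=\max(Y_-\cup\sigma(Y_+))$, $b_+=\min(Y_+\cup\sigma(Y_-))$; by convention $b_-=0$ and $b_+=N+1$ if $Y=\varnothing$. One has $b_-<b_+$.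
   Formalization: The case q² = −1 is admitted only when the parity function is constant: for q = ±i and both parities present, an odd matrix unit e_ij with [i] ≠ [j] satisfies the reflection equation but is not of the stated form. *)

(* Defs.v *)
From HB Require Import structures.
From mathcomp Require Import all_boot all_order all_algebra.
From mathcomp Require Import reals.
From mathcomp Require Export complex mxtens.

Set Implicit Arguments.
Unset Strict Implicit.
Unset Printing Implicit Defensive.

Import Order.TTheory GRing.Theory Num.Theory.
Local Open Scope ring_scope.

(* End(V) is 'M_N acting on column vectors, so that delta_mx i j is the matrix
   unit e_ij = e^i_j.  The vector space End(V) (x) End(V) is 'M_(N * N), with
   a (x) b the Kronecker product a *t b.  The parity of the basis vector v_i
   is par i : bool. *)

Section GradedTensor.

Variables (F : fieldType) (N : nat) (par : 'I_N -> bool).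

Definition unit_deg (i j : 'I_N) : bool := par i (+) par j.

Definition homogeneous (d : bool) (a : 'M[F]_N) : Prop :=
  forall i j, a i j != 0 -> unit_deg i j = d.

(* The bilinear extension of the graded product of matrix units: the (r, s)
   entry of T is the coefficient of e_{r1 s1} (x) e_{r2 s2}, the (s, c) entry
   of U that of e_{s1 c1} (x) e_{s2 c2}, and their product carries the sign
   (-1)^(deg e_{s1 c1} * deg e_{r2 s2}). *)
Definition gmul (T U : 'M[F]_(N * N)) : 'M[F]_(N * N) :=
  \matrix_(r, c) \sum_s
    (-1) ^+ (unit_deg (mxtens_unindex s).1 (mxtens_unindex c).1
             && unit_deg (mxtens_unindex r).2 (mxtens_unindex s).2)
    * T r s * U s c.

Lemma gmul_tens (d1 d2 : bool) (a1 b1 a2 b2 : 'M[F]_N) :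
  homogeneous d1 b1 -> homogeneous d2 a2 ->
  gmul (a1 *t b1) (a2 *t b2)
    = (-1) ^+ (d2 && d1) *: ((a1 *m a2) *t (b1 *m b2)).
Proof.
move=> hb ha; rewrite -tensmx_mul; apply/matrixP => r c; rewrite !mxE mulr_sumr.
apply: eq_bigr => s _; rewrite -mulrA.
case: (eqVneq (b1 (mxtens_unindex r).2 (mxtens_unindex s).2) 0) => [b0|/hb ->].
  by rewrite !mxE b0 mulr0 mul0r !mulr0.
case: (eqVneq (a2 (mxtens_unindex s).1 (mxtens_unindex c).1) 0) => [a0|/ha -> //].
by rewrite !mxE a0 mul0r !mulr0.
Qed.

Lemma gmul_linearl (k : F) (T T' U : 'M[F]_(N * N)) :
  gmul (k *: T + T') U = k *: gmul T U + gmul T' U.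
Proof.
apply/matrixP => r c; rewrite !mxE mulr_sumr -big_split; apply: eq_bigr => s _.
by rewrite !mxE /= mulrDr mulrDl !mulrA [k * _]mulrC.
Qed.

Lemma gmul_linearr (k : F) (T U U' : 'M[F]_(N * N)) :
  gmul T (k *: U + U') = k *: gmul T U + gmul T U'.
Proof.
apply/matrixP => r c; rewrite !mxE mulr_sumr -big_split; apply: eq_bigr => s _.
by rewrite !mxE /= mulrDr; congr (_ + _); rewrite mulrCA.
Qed.

Definition Rmx (q : F) : 'M[F]_(N * N) :=
  \sum_(i < N) \sum_(j < N) q ^ ((-1) ^+ par i * (i == j)%:R) *:
    (delta_mx i i *t delta_mx j j)
  + (q - q^-1) *: \sum_(i < N) \sum_(j < N | (j < i)%N)
    (-1) ^+ par j *: (delta_mx i j *t delta_mx j i).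

Definition Pmx : 'M[F]_(N * N) :=
  \sum_(i < N) \sum_(j < N) (-1) ^+ par j *: (delta_mx i j *t delta_mx j i).

Definition Smx (q : F) : 'M[F]_(N * N) := gmul Pmx (Rmx q).

Definition leg2 (A : 'M[F]_N) : 'M[F]_(N * N) := 1%:M *t A.

Definition reflection_eq (q : F) (A : 'M[F]_N) : Prop :=
  gmul (gmul (gmul (Smx q) (leg2 A)) (Smx q)) (leg2 A)
  = gmul (gmul (gmul (leg2 A) (Smx q)) (leg2 A)) (Smx q).

(* The hypotheses q <> 0, 1, -1 alone do not suffice when both parities occur:
   with v_1 even and v_2 odd, the odd matrix A = e_12 gives
     S A_2 S A_2 = q e_12 (x) e_12   and   A_2 S A_2 S = - q^-1 e_12 (x) e_12,
   so it satisfies the reflection equation when q^2 = -1, although it is not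
   of the form allowed by parity-preserving maps sigma.  The values q^2 = -1
   are therefore admitted only if all basis vectors have the same parity. *)
Definition regular_parameter (q : F) : Prop :=
  q ^+ 2 = -1 -> forall i j : 'I_N, par i = par j.

End GradedTensor.

Section AdmissiblePairs.

Variables (N : nat) (par : 'I_N -> bool).

(* 'I_N is 0-based: i : 'I_N stands for the element idx i of [1, N]. *)
Definition idx (i : 'I_N) : nat := i.+1.

(* A map Y -> I is represented by a total function, only the values of which
   on Y are ever used. *)
Definition admissible (Y : {set 'I_N}) (sigma : 'I_N -> 'I_N) : Prop :=
  [/\ {in Y &, forall i j, (idx i < idx j)%N -> (idx (sigma j) < idx (sigma i))%N},
      {in Y, forall i, par (sigma i) = par i}
    & {in Y, forall i, sigma i != i}].

Variables (Y : {set 'I_N}) (sigma : 'I_N -> 'I_N).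

Definition Yplus : {set 'I_N} := [set i in Y | (idx (sigma i) < idx i)%N].
Definition Yminus : {set 'I_N} := [set i in Y | (idx i < idx (sigma i))%N].

Definition bminus : nat := \max_(i in Yminus :|: sigma @: Yplus) idx i.
Definition bplus : nat :=
  \big[minn/N.+1]_(i in Yplus :|: sigma @: Yminus) idx i.

End AdmissiblePairs.

Section Types.

Variables (F : fieldType) (N : nat) (par : 'I_N -> bool).

Definition type1 (Y : {set 'I_N}) (sigma : 'I_N -> 'I_N) (x y : 'I_N -> F) :
    Prop :=
  admissible par Y sigma /\
  exists bm bp : nat,
    [/\ (0 < bm)%N, (0 < bp)%N, (bm < bp)%N & (bm + bp <= N + 1)%N] /\
    Y = [set i | (1 <= idx i <= bm)%N || (bp <= idx i <= bp + bm - 1)%N] /\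
    {in Y, forall i, idx (sigma i) = (bp + bm - idx i)%N} /\
    exists lam mu : F,
      [/\ forall i, (1 <= idx i <= bm)%N -> x i = lam + mu,
          forall i, (bm < idx i < bp)%N -> x i = lam,
          forall i, (bp <= idx i <= N)%N -> x i = 0
        & {in Y, forall i, y i * y (sigma i) = - (lam * mu) /\
                           - (lam * mu) != 0}].

Definition type2 (Y : {set 'I_N}) (sigma : 'I_N -> 'I_N) (x y : 'I_N -> F) :
    Prop :=
  admissible par Y sigma /\ Y :&: sigma @: Y = set0 /\
  exists (b : nat) (lam : F),
    [/\ (bminus Y sigma <= b < bplus Y sigma)%N,
        forall i, (1 <= idx i <= b)%N -> x i = lam,
        forall i, (b < idx i <= N)%N -> x i = 0
      & {in Y, forall i, y i != 0}].

End Types.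

(* Main.v *)
Require Import Defs.
From mathcomp Require Import all_boot all_order all_algebra.
From mathcomp Require Import reals.
From mathcomp Require Import zify ring.
Import GRing.Theory Num.Theory.
Local Open Scope ring_scope.

(** Let h_i be q for even i and q^-1 for odd i, let w_i = h_i - h_i^-1, and let
    T_a(b, d) be the sum of A_be A_ed over e > a.

    The matrix S has at most two nonzero entries in each row and column, so the
    reflection equation is one scalar equation for each quadruple a, b, c, d
    ([reflection_eqE]), quadratic in the entries of A.  The quadruple a, a, c, c
    with a, c of different parities says that (q + q^-1) A_ac^2 = 0; hence A is
    even ([reflection_par_even]).  For even A the signs of the graded product
    all cancel and parity survives only in the weights h_i: the equations become
    [defect] = 0 ([reflection_defect]).

    Quadruples with coinciding indices then isolate products of two entries.
    As h_i is neither 0 nor 1 and w_i is not 0, they say that A is diagonal plus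
    a partial permutation j -> sigma j that reverses the order and has no chains
    d -> e -> a with a <> d, that the diagonal x vanishes from the larger
    endpoint of each arc onwards and is constant up to the smaller one, and that
      T_b(a, a) + x_a x_b = T_a(b, b)    for a < b.
    These conditions are [normal_form].  Conversely, under them the products of
    entries in each [defect] vanish or cancel ([defect_of_normal_form]).

    What remains is combinatorics.  Let z_j = y_j y_(sigma j) if j is on a
    2-cycle of sigma and z_j = 0 otherwise; the last condition reads
      [b < sigma a] z_a + x_a x_b = x_b^2 + [a < sigma b] z_b    for a < b.
    Without 2-cycles it is x_b (x_b - x_a) = 0, so x is a step function: type 2.
    Otherwise let m < M = sigma m be the innermost 2-cycle.  The condition for
    (a, M) puts all a <= m on 2-cycles with the same z, and then the condition
    for (1, b) puts all b between M and sigma 1 on 2-cycles; a decreasing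
    involution of these two intervals must be i -> m + M - i.  An arc which is
    not a 2-cycle would have an endpoint k in (m, M) with x_k = x_m, and the
    condition for (m, k) would give z_m = 0.  Finally
    x_b (x_b - x_m) = z_m and x_b (x_b - x_a) = 0 for m < a < b < M give one
    value lambda on (m, M), and mu = x_m - lambda: type 1.  If (m, M) is empty,
    lambda is a root of l^2 = x_m l + z_m, which exists over an algebraically
    closed field. *)

Set Implicit Arguments.
Unset Strict Implicit.
Unset Printing Implicit Defensive.

Lemma forall4_iff (T : Type) (P Q : T -> T -> T -> T -> Prop) :
  (forall x y z t, P x y z t <-> Q x y z t) ->
  (forall x y z t, P x y z t) <-> (forall x y z t, Q x y z t).
Proof. by move=> PQ; split=> H x y z t; apply/PQ/H. Qed.

(** * Entries of the reflection equation *)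

Section Entries.

Variables (F : fieldType) (N : nat) (par : 'I_N -> bool) (q : F).

Implicit Types (a b c d e : 'I_N) (A : 'M[F]_N) (T U : 'M[F]_(N * N)).

(** The row and column of T in End(V) (x) End(V) are split into their two tensor
    factors: this is the coefficient of e_ac (x) e_bd. *)
Definition entry T a b c d : F := T (mxtens_index (a, b)) (mxtens_index (c, d)).

Lemma entry_inj T U :
  (forall a b c d, entry T a b c d = entry U a b c d) -> T = U.
Proof.
move=> TU; apply/matrixP => r c.
case: (mxtens_indexP r) => r1 r2; case: (mxtens_indexP c) => c1 c2.
exact: TU.
Qed.

Lemma sum_pair1 a b (f : 'I_N -> 'I_N -> F) :
  (forall i j, i != a -> f i j = 0) -> (forall j, j != b -> f a j = 0) ->
  \sum_i \sum_j f i j = f a b.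
Proof.
move=> fa fb; rewrite (bigD1 a) //= [X in _ + X]big1 ?addr0; last first.
  by move=> i ia; apply: big1 => j _; apply: fa.
by rewrite (bigD1 b) //= big1 ?addr0.
Qed.

Lemma sum_tens (f : 'I_(N * N) -> F) :
  \sum_s f s = \sum_i \sum_j f (mxtens_index (i, j)).
Proof.
rewrite pair_big /= (reindex (@mxtens_index N N)) /=.
  by apply: eq_bigr => -[i j].
by exists (@mxtens_unindex N N) => ? _; rewrite ?mxtens_indexK ?mxtens_unindexK.
Qed.

Lemma entry_gmul T U a b c d :
  entry (gmul par T U) a b c d =
  \sum_i \sum_j (-1) ^+ ((par i (+) par c) && (par b (+) par j))
                * entry T a b i j * entry U i j c d.
Proof.
rewrite /entry mxE sum_tens; apply: eq_bigr => i _; apply: eq_bigr => j _.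
by rewrite !mxtens_indexK.
Qed.

Lemma entry_leg2 A a b c d : entry (leg2 A) a b c d = (a == c)%:R * A b d.
Proof. by rewrite /entry tensmxE mxE. Qed.

(** The factor 1 (x) A forces the first column index to stay c, and then the
    Koszul sign has the even factor e_cc: multiplying by A_2 on the right brings
    in no sign. *)
Lemma entry_gmul_leg2r T A a b c d :
  entry (gmul par T (leg2 A)) a b c d = \sum_e entry T a b c e * A e d.
Proof.
rewrite entry_gmul (bigD1 c) //= [X in _ + X]big1 ?addr0; last first.
  by move=> i ic; apply: big1 => j _; rewrite entry_leg2 (negPf ic) mul0r mulr0.
by apply: eq_bigr => j _; rewrite entry_leg2 eqxx addbb expr0 !mul1r.
Qed.

(** The coefficient of e_aa (x) e_aa in R. *)
Definition qpow a : F := q ^ ((-1) ^+ par a).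
Definition psign a : F := (-1) ^+ par a.
(** The coefficient of e_ab (x) e_ba in S.  The diagonal one carries a sign
    because of P. *)
Definition flip a b : F := if a == b then psign a * qpow a else psign b.

Lemma entry_Pmx a b c d :
  entry (Pmx F par) a b c d = ((a == d) && (b == c))%:R * psign b.
Proof.
rewrite /entry summxE (eq_bigr (fun i => \sum_j
  psign j * (((a == i) && (c == j))%:R * ((b == j) && (d == i))%:R))); last first.
  move=> i _; rewrite summxE; apply: eq_bigr => j _.
  by rewrite mxE tensmxE !mxE.
rewrite (@sum_pair1 a b) => [|i j ia|j jb].
- by rewrite !eqxx /= -mulnb natrM (eq_sym c) (eq_sym d) mulrC; ring.
- by rewrite (eq_sym a) (negPf ia) mul0r mulr0.
- by rewrite (eq_sym b) (negPf jb) !mulr0.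
Qed.

Lemma entry_Rmx a b c d :
  entry (Rmx par q) a b c d =
  ((a == c) && (b == d))%:R * (if a == b then qpow a else 1)
  + ((a == d) && (b == c) && (b < a)%N)%:R * (q - q^-1) * psign b.
Proof.
rewrite /entry mxE; congr (_ + _).
  rewrite summxE (eq_bigr (fun i => \sum_j q ^ ((-1) ^+ par i * (i == j)%:R) *
    (((a == i) && (c == i))%:R * ((b == j) && (d == j))%:R))); last first.
    move=> i _; rewrite summxE; apply: eq_bigr => j _.
    by rewrite mxE tensmxE !mxE.
  rewrite (@sum_pair1 a b) => [|i j ia|j jb].
  - rewrite !eqxx /= -mulnb natrM (eq_sym c) (eq_sym d) mulrC; congr (_ * _).
    by case: eqP => _; rewrite ?mulr1 ?mulr0.
  - by rewrite (eq_sym a) (negPf ia) mul0r mulr0.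
  - by rewrite (eq_sym b) (negPf jb) !mulr0.
rewrite mxE summxE (eq_bigr (fun i : 'I_N => \sum_(j < N) (j < i)%N%:R * psign j *
    (((a == i) && (c == j))%:R * ((b == j) && (d == i))%:R))); last first.
  move=> i _; rewrite summxE big_mkcond; apply: eq_bigr => j _.
  by case: ifP; rewrite ?mul0r // mul1r mxE tensmxE !mxE.
rewrite (@sum_pair1 a b) => [|i j ia|j jb].
- rewrite !eqxx /= -!mulnb !natrM (eq_sym c) (eq_sym d); ring.
- by rewrite (eq_sym a) (negPf ia) mul0r mulr0.
- by rewrite (eq_sym b) (negPf jb) !mulr0.
Qed.

(** Multiplication by P on the left exchanges the two row indices of R.  In
    the terms e_aa (x) e_bb, a < b, which come from the triangular part of R,
    its sign cancels against that of R and the Koszul sign. *)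
Lemma entry_Smx a b c d :
  entry (Smx par q) a b c d =
  ((a == d) && (b == c))%:R * flip a b
  + ((a == c) && (b == d) && (a < b)%N)%:R * (q - q^-1).
Proof.
rewrite entry_gmul (@sum_pair1 b a) => [|i j ib|j ja]; last first.
- by rewrite entry_Pmx (eq_sym a) (negPf ja) mul0r mulr0 mul0r.
- by rewrite entry_Pmx (eq_sym b) (negPf ib) andbF mul0r mulr0 mul0r.
rewrite entry_Pmx entry_Rmx !eqxx mul1r mulrDr; congr (_ + _).
  rewrite andbC; case: eqP => [<-|_]; last by rewrite andbF !mul0r mulr0.
  rewrite addbb /= (eq_sym b a) andbC /flip /psign.
  move: (a == d) => ad; case: eqP => [->|_]; case: ad => /=; ring.
rewrite [(b == d) && _]andbC -!andbA /psign.
case: eqP => [<-|_] /=; last by ring.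
by case: (par a); case: (par b) => /=; ring.
Qed.

Lemma entry_gmul_Smxr T a b c d :
  entry (gmul par T (Smx par q)) a b c d =
  (-1) ^+ ((par d (+) par c) && (par b (+) par c)) * entry T a b d c * flip d c
  + (c < d)%N%:R * (q - q^-1) * entry T a b c d.
Proof.
rewrite entry_gmul.
under eq_bigr => i _ do under eq_bigr => j _ do rewrite entry_Smx mulrDr.
under eq_bigr => i _ do rewrite big_split.
rewrite big_split; congr (_ + _).
  rewrite (@sum_pair1 d c) => [|i j ia|j jb].
  - by rewrite !eqxx mul1r.
  - by rewrite (negPf ia) mul0r mulr0.
  - by rewrite (negPf jb) andbF mul0r mulr0.
rewrite (@sum_pair1 c d) => [|i j ia|j jb].
- by rewrite !eqxx addbb expr0 /=; ring.
- by rewrite (negPf ia) mul0r mulr0.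
- by rewrite (negPf jb) andbF mul0r mulr0.
Qed.

(** The upper triangular part of S truncates the matrix product A A to
    intermediate indices beyond a; these truncated products are the only sums
    left in the entries of the reflection equation. *)
Definition tail_sum A a b d : F := \sum_(e : 'I_N | (a < e)%N) A b e * A e d.

Lemma entry_SA A a b c d :
  entry (gmul par (Smx par q) (leg2 A)) a b c d =
  (b == c)%:R * flip a b * A a d + ((a == c) && (a < b)%N)%:R * (q - q^-1) * A b d.
Proof.
rewrite entry_gmul_leg2r.
under eq_bigr => e _ do rewrite entry_Smx mulrDl.
rewrite big_split; congr (_ + _).
  rewrite (bigD1 a) //= big1 ?addr0 ?eqxx // => e ea.
  by rewrite eq_sym (negPf ea) !mul0r.
rewrite (bigD1 b) //= big1 ?addr0 ?eqxx ?andbT // => e eb.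
by rewrite (eq_sym b) (negPf eb) andbF !mul0r.
Qed.

Lemma entry_AS A a b c d :
  entry (gmul par (leg2 A) (Smx par q)) a b c d =
  (a == d)%:R * (-1) ^+ ((par a (+) par c) && (par b (+) par c))
     * flip a c * A b c
  + ((a == c) && (a < d)%N)%:R * (q - q^-1) * A b d.
Proof.
rewrite entry_gmul_Smxr !entry_leg2; congr (_ + _).
  by case: eqP => [->|_] /=; ring.
by case: eqP => [->|_] /=; ring.
Qed.

Lemma entry_SASA A a b c d :
  entry (gmul par (gmul par (gmul par (Smx par q) (leg2 A)) (Smx par q))
    (leg2 A)) a b c d =
  (-1) ^+ (par b (+) par c) * flip b c * flip a b * A a c * A b d
  + (a < b)%N%:R * (q - q^-1) * (-1) ^+ ((par a (+) par c) && (par b (+) par c))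
    * flip a c * A b c * A a d
  + (b == c)%:R * (q - q^-1) * flip a b * tail_sum A c a d
  + ((a == c) && (a < b)%N)%:R * (q - q^-1) ^+ 2 * tail_sum A c b d.
Proof.
rewrite entry_gmul_leg2r; under eq_bigr => e _ do rewrite entry_gmul_Smxr !entry_SA.
move: (q - q^-1) => w; under eq_bigr => e _ do rewrite !(mulrDr, mulrDl) -addrA.
rewrite !big_split /= -!addrA; congr (_ + _); [|congr (_ + _); [|congr (_ + _)]].
- rewrite (bigD1 b) //= big1 ?addr0 ?eqxx /= ?andbb; first by ring.
  by move=> e eb; rewrite (eq_sym b) (negPf eb) !(mul0r, mulr0).
- rewrite (bigD1 a) //= big1 ?addr0 ?eqxx /=; first by ring.
  by move=> e eb; rewrite (eq_sym a) (negPf eb) !(mul0r, mulr0).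
- rewrite /tail_sum [in RHS]big_mkcond mulr_sumr; apply: eq_bigr => e _.
  by case: ifP => _ /=; ring.
- rewrite /tail_sum [in RHS]big_mkcond mulr_sumr; apply: eq_bigr => e _.
  by case: ifP => _ /=; ring.
Qed.

Lemma entry_ASA A a b c d :
  entry (gmul par (gmul par (leg2 A) (Smx par q)) (leg2 A)) a b c d =
  (-1) ^+ ((par a (+) par c) && (par b (+) par c)) * flip a c * A b c * A a d
  + (a == c)%:R * (q - q^-1) * tail_sum A a b d.
Proof.
rewrite entry_gmul_leg2r.
under eq_bigr => e _ do rewrite entry_AS mulrDl.
rewrite big_split /=; congr (_ + _).
  rewrite (bigD1 a) //= big1 ?addr0 ?eqxx /=; first by ring.
  by move=> e eb; rewrite (eq_sym a) (negPf eb) !(mul0r, mulr0).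
rewrite /tail_sum [in RHS]big_mkcond mulr_sumr; apply: eq_bigr => e _.
by case: (a == c); case: (a < e)%N => /=; ring.
Qed.

Lemma reflection_eqE A :
  reflection_eq par q A <->
  forall a b c d,
  (-1) ^+ (par b (+) par c) * flip b c * flip a b * A a c * A b d
  + (a < b)%N%:R * (q - q^-1) * (-1) ^+ ((par a (+) par c) && (par b (+) par c))
    * flip a c * A b c * A a d
  + (b == c)%:R * (q - q^-1) * flip a b * tail_sum A c a d
  + ((a == c) && (a < b)%N)%:R * (q - q^-1) ^+ 2 * tail_sum A c b d
  = (-1) ^+ ((par d (+) par c) && (par b (+) par c)) *
     ((-1) ^+ ((par a (+) par d) && (par b (+) par d)) * flip a d * A b d * A a c
      + (a == d)%:R * (q - q^-1) * tail_sum A a b c) * flip d c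
    + (c < d)%N%:R * (q - q^-1) *
     ((-1) ^+ ((par a (+) par c) && (par b (+) par c)) * flip a c * A b c * A a d
      + (a == c)%:R * (q - q^-1) * tail_sum A a b d).
Proof.
split=> [AE a b c d|AE].
  by rewrite -entry_SASA AE entry_gmul_Smxr !entry_ASA.
by apply: entry_inj => a b c d; rewrite entry_SASA AE entry_gmul_Smxr !entry_ASA.
Qed.

Lemma qpowE a : qpow a = if par a then q^-1 else q.
Proof. by rewrite /qpow; case: (par a); rewrite ?expr1 ?expr0 ?exprN1 ?expr1z. Qed.

Definition par_even A : Prop := forall i j, A i j != 0 -> par i = par j.

(** For indices a and c of different parities the entry at a, a, c, c of the
    reflection equation amounts to (q + q^-1) A_ac^2 = 0, and q^2 = -1 is
    excluded when such indices exist. *)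
Lemma reflection_par_even A :
  q != 0 -> regular_parameter par q -> reflection_eq par q A -> par_even A.
Proof.
move=> q0 qreg /reflection_eqE AE a c Aac0; apply/eqP/negP => /negP pac.
have ac : a != c by apply: contraNneq pac => ->.
have := AE a a c c; rewrite addbb ltnn (negPf ac) ltnn /= !mul0r !addr0.
rewrite andbb mul1r.
have -> : par a (+) par c by case: (par a) (par c) pac => [] [].
rewrite /flip (negPf ac) !eqxx /psign !qpowE => /eqP.
have qq : q + q^-1 != 0.
  apply: contraNneq pac => /eqP; rewrite addr_eq0 => /eqP qq.
  by rewrite (qreg _ a c) // expr2 {2}qq mulrN divff.
rewrite -subr_eq0 (_ : _ - _ = (A a c) ^+ 2 * (q + q^-1)).
  by rewrite mulf_eq0 expf_eq0 (negPf Aac0) (negPf qq).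
by case: (par a) (par c) pac => [] [] //= _; ring.
Qed.

Definition omega c : F := qpow c - (qpow c)^-1.
(** With the sign removed, [flip] depends on parity only through the diagonal,
    see [flipE]. *)
Definition dqpow a b : F := if a == b then qpow a else 1.

Lemma omegaE c : omega c = psign c * (q - q^-1).
Proof.
by rewrite /omega /psign qpowE; case: (par c); rewrite /= ?invrK; ring.
Qed.

Lemma flipE a b : flip a b = psign b * dqpow a b.
Proof. by rewrite /flip /dqpow; case: eqP => [->|]; rewrite ?mulr1. Qed.

(** The difference of the two sides of the reflection equation in the ungraded
    form which it takes for even A: no sign is left, and parity enters only
    through the weights [qpow]. *)
Definition defect A a b c d : F :=
  (dqpow a b * dqpow b c - dqpow a d * dqpow d c) * A a c * A b d
  + omega c * ((a < b)%N%:R - (c < d)%N%:R)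
    * (dqpow a c * A b c * A a d + (a == c)%:R * omega c * tail_sum A a b d)
  + omega c * ((b == c)%:R * dqpow a b * tail_sum A c a d
               - (a == d)%:R * dqpow d c * tail_sum A a b c).

(** Each product of entries in the equation forces its parities to agree in
    pairs when A is even, and then its Koszul signs and the signs of [flip]
    multiply to 1, or to the sign that turns q - q^-1 into [omega]. *)
Lemma reflection_defect A : par_even A ->
  reflection_eq par q A <-> forall a b c d, defect A a b c d = 0.
Proof.
move=> evA.
have A0 x y : A x y = (par x == par y)%:R * A x y.
  by case: eqP => [_|xy]; rewrite (mul1r, mul0r) //; apply/eqP/negP => /negP /evA.
have T0 e x y : tail_sum A e x y = (par x == par y)%:R * tail_sum A e x y.
  rewrite /tail_sum mulr_sumr; apply: eq_bigr => f _.
  rewrite (A0 x f) (A0 f y).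
  by case: (par x); case: (par f); case: (par y) => /=; ring.
rewrite reflection_eqE; apply: forall4_iff => a b c d.
set L := (X in X = _); set M := (X in _ = X).
suff -> : defect A a b c d = L - M.
  by split=> [->|/eqP]; [rewrite subrr | rewrite subr_eq0 => /eqP].
rewrite /L /M /defect !flipE !omegaE.
have -> : (b == c)%:R * (q - q^-1) * (psign b * dqpow a b) =
  (b == c)%:R * (q - q^-1) * (psign c * dqpow a b).
  by case: eqP => [->|_] //; rewrite !mul0r.
have -> : ((a == c) && (a < b)%N)%:R * (q - q^-1) ^+ 2 * tail_sum A c b d =
  (a == c)%:R * (a < b)%N%:R * (q - q^-1) ^+ 2 * tail_sum A a b d.
  by rewrite -mulnb natrM; case: eqP => [->|_] //; rewrite !mul0r.
(* Each entry now carries the indicator that its two parities agree, so that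
   only the values of four parities remain to be checked. *)
rewrite (A0 a c) (A0 b d) (A0 b c) (T0 a b c) /psign.
by case: (par a); case: (par b); case: (par c); case: (par d) => /=; ring.
Qed.

End Entries.

(** * From the entry equations to a normal form *)

Section Normal.

Variables (F : fieldType) (N : nat) (par : 'I_N -> bool) (q : F).

Implicit Types (a b c d e : 'I_N) (A : 'M[F]_N).

(** The equations [defect] = 0 solved for the positions of nonzero entries.  The
    first field says that the off-diagonal entries form a partial permutation
    matrix of an order-reversing map: equal columns c = d force equal rows, and
    conversely. *)
Record normal_form A : Prop := NormalForm {
  nf_order : forall a b c d, A b c != 0 -> A a d != 0 -> b != c -> a != d ->
    (c < d)%N = (a < b)%N;
  nf_chain : forall a e d, A a e != 0 -> A e d != 0 -> a != e -> e != d -> a = d;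
  nf_hi : forall a d b, A a d != 0 -> a != d -> (a <= b)%N -> (d <= b)%N ->
    A b b = 0;
  nf_lo : forall a d b, A a d != 0 -> a != d -> (b <= a)%N -> (b <= d)%N ->
    A b b = A a a + A d d;
  nf_diag : forall a b, (a < b)%N ->
    tail_sum A b a a + A a a * A b b = tail_sum A a b b }.

(** When the summands with two off-diagonal factors vanish, only e = a and
    e = d remain. *)
Lemma tail_sum_off A b a d :
  (forall e, a != e -> e != d -> A a e * A e d = 0) -> a != d ->
  tail_sum A b a d = ((b < a)%N%:R * A a a + (b < d)%N%:R * A d d) * A a d.
Proof.
move=> A0 ad; rewrite /tail_sum big_mkcond (bigD1 a) //= (bigD1 d) ?(eq_sym d) //=.
rewrite big1 => [|e /andP[ea ed]]; last by rewrite A0 ?if_same // eq_sym.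
by case: (b < a)%N; case: (b < d)%N => /=; ring.
Qed.

Lemma dqpow_diag a : dqpow par q a a = qpow par q a.
Proof. by rewrite /dqpow eqxx. Qed.

Lemma dqpow_off a b : a != b -> dqpow par q a b = 1.
Proof. by rewrite /dqpow => /negPf ->. Qed.

Section OfDefect.

Hypotheses (q0 : q != 0) (q1 : q != 1) (qN1 : q != -1).
Variable A : 'M[F]_N.
Hypotheses (evA : par_even par A).

Lemma qpow_neq0 a : qpow par q a != 0.
Proof. by rewrite qpowE; case: (par a); rewrite ?invr_eq0. Qed.

Lemma qpow_neq1 a : qpow par q a != 1.
Proof. by rewrite qpowE; case: (par a); rewrite ?invr_eq1. Qed.

Lemma omega_neq0 a : omega par q a != 0.
Proof.
rewrite omegaE mulf_neq0 ?signr_eq0 //.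
have -> : q - q^-1 = (q - 1) * (q + 1) / q by field.
by rewrite !mulf_neq0 ?invr_eq0 ?subr_eq0 ?addr_eq0.
Qed.

Lemma par_even_qpow a b : A a b != 0 -> qpow par q a = qpow par q b.
Proof. by move=> /evA; rewrite !qpowE => ->. Qed.

Hypothesis D0 : forall a b c d, defect par q A a b c d = 0.

(** For c < d the equation at a, a, c, d is (h_a^-1 - 1) A_ac A_ad = 0, since
    h_a = h_c when A_ac is nonzero. *)
Lemma defect_row a c d : A a c != 0 -> A a d != 0 -> a != c -> a != d -> c = d.
Proof.
wlog cd : c d / (c < d)%N => [W|] Ac Ad ac ad.
  by case: (ltngtP c d) => [/W|/W|/val_inj] -> //.
have := D0 a a c d; rewrite /defect (negPf ac) (negPf ad) dqpow_diag !dqpow_off //;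
  last first.
  by rewrite -val_eqE /= gtn_eqF.
rewrite ltnn cd /omega -(par_even_qpow Ac) => E.
have : (1 - qpow par q a) * (A a c * A a d) == 0.
  apply/eqP; rewrite -[RHS](mulr0 (qpow par q a)) -E.
  by move=> /=; field; exact: qpow_neq0.
by rewrite !mulf_eq0 (negPf Ac) (negPf Ad) !orbF subr_eq0 eq_sym (negPf (qpow_neq1 a)).
Qed.

(** The transpose of [defect_row], from the equation at a, b, c, c. *)
Lemma defect_col a b c : A a c != 0 -> A b c != 0 -> a != c -> b != c -> a = b.
Proof.
wlog ab : a b / (a < b)%N => [W|] Ac Bc ac bc.
  by case: (ltngtP a b) => [/W|/W|/val_inj] -> //.
have := D0 a b c c; rewrite /defect (negPf ac) (negPf bc) dqpow_diag !dqpow_off //;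
  last first.
  by rewrite -val_eqE /= ltn_eqF.
rewrite ltnn ab /omega => E.
have : (1 - qpow par q c) * (A a c * A b c) == 0.
  apply/eqP; rewrite -[RHS](mulr0 (- qpow par q c)) -E.
  by move=> /=; field; exact: qpow_neq0.
by rewrite !mulf_eq0 (negPf Ac) (negPf Bc) !orbF subr_eq0 eq_sym (negPf (qpow_neq1 c)).
Qed.

(** By [defect_row] and [defect_col] every other product in the equation at
    a, e, e, d contains a vanishing entry, so it reduces to
    (h_e - 1) A_ae A_ed = 0. *)
Lemma defect_chain a e d : A a e != 0 -> A e d != 0 -> a != e -> e != d -> a = d.
Proof.
move=> Ae Ed ae ed; apply/eqP/negP => /negP ad.
have Ad : A a d = 0.
  by apply/eqP/negP => /negP Ad; rewrite (defect_col Ad Ed) ?eqxx in ae.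
have T0 : tail_sum A e a d = 0.
  apply: big1 => f ef; have [->|fa] := eqVneq f a; first by rewrite Ad mulr0.
  have [->|Af] := eqVneq (A a f) 0; first by rewrite mul0r.
  by rewrite (defect_row Ae Af) ?ltnn // eq_sym in ef.
have := D0 a e e d; rewrite /defect (negPf ae) (negPf ad) dqpow_diag !dqpow_off //;
  last first.
  by rewrite eq_sym.
move=> E; have : (qpow par q e - 1) * (A a e * A e d) == 0.
  by apply/eqP; rewrite -[RHS]E Ad T0 /=; ring.
by rewrite !mulf_eq0 (negPf Ae) (negPf Ed) !orbF subr_eq0 (negPf (qpow_neq1 e)).
Qed.

(** If a, b, c are distinct and d differs from a and c, the terms without
    [omega] cancel, and the rest is w_c ([a < b] - [c < d]) A_bc A_ad = 0.
    The cases a = c, a = b and c = d are [defect_chain], [defect_row] and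
    [defect_col]. *)
Lemma defect_order a b c d : A b c != 0 -> A a d != 0 -> b != c -> a != d ->
  (c < d)%N = (a < b)%N.
Proof.
move=> Bc Ad bc ad; have [ac|ac] := eqVneq a c.
  by rewrite -ac in Bc bc *; rewrite (defect_chain Bc Ad).
have [ab|ab] := eqVneq a b.
  by rewrite ab in Ad ad *; rewrite (defect_row Bc Ad) ?ltnn.
have [cd|cd] := eqVneq c d.
  by rewrite -cd in Ad ad *; rewrite (defect_col Bc Ad) ?ltnn.
have := D0 a b c d; rewrite /defect (negPf ac) (negPf ad) (negPf bc) !dqpow_off //;
  last first.
  by rewrite eq_sym.
move=> E; have : omega par q c * ((a < b)%N%:R - (c < d)%N%:R) * (A b c * A a d) == 0.
  by apply/eqP; rewrite -[RHS]E /=; ring.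
rewrite !mulf_eq0 (negPf Bc) (negPf Ad) (negPf (omega_neq0 c)) !orbF /=.
by case: (c < d)%N; case: (a < b)%N; rewrite //= ?subr0 ?sub0r ?oppr_eq0 oner_eq0.
Qed.

Lemma defect_tail b a d : a != d ->
  tail_sum A b a d = ((b < a)%N%:R * A a a + (b < d)%N%:R * A d d) * A a d.
Proof.
move=> ad; apply: tail_sum_off => // e ae ed.
have [->|Ae] := eqVneq (A a e) 0; first by rewrite mul0r.
have [->|Ed] := eqVneq (A e d) 0; first by rewrite mulr0.
by rewrite (defect_chain Ae Ed) ?eqxx in ad.
Qed.

(** The equation at a, b, b, d, in which A_ab A_bd vanishes by [defect_chain]. *)
Lemma defect_offdiag a d b : A a d != 0 -> a != d -> a != b -> b != d ->
  ((a < b)%N%:R - (b < d)%N%:R) * A b b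
  + ((b < a)%N%:R * A a a + (b < d)%N%:R * A d d) = 0.
Proof.
move=> Ad ad ab bd; have db : d != b by rewrite eq_sym.
have := D0 a b b d.
rewrite /defect (negPf ab) (negPf ad) eqxx dqpow_diag !dqpow_off // (defect_tail b ad).
have A0 : A a b * A b d = 0.
  have [->|Ab] := eqVneq (A a b) 0; first by rewrite mul0r.
  have [->|Bd] := eqVneq (A b d) 0; first by rewrite mulr0.
  by rewrite (defect_chain Ab Bd) ?eqxx in ad.
move=> E; apply: (mulfI (omega_neq0 b)); apply: (mulIf Ad).
by rewrite mulr0 mul0r -[RHS]E -(mulrA _ (A a b)) A0 /=; ring.
Qed.

(** The equation at a, a, a, d: it multiplies A_ad by the diagonal entry at the
    larger of a and d and by a nonzero constant. *)
Lemma defect_max0 a d : A a d != 0 -> a != d ->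
  (if (a < d)%N then A d d else A a a) = 0.
Proof.
move=> Ad ad; have da : d != a by rewrite eq_sym.
have := D0 a a a d.
rewrite /defect (negPf ad) !eqxx dqpow_diag !dqpow_off // (defect_tail _ ad) ltnn => E.
apply: (mulfI (omega_neq0 a)); apply: (mulIf Ad).
case: ltnP => ltad; rewrite mulr0 mul0r.
  rewrite ltad in E; apply: (mulfI (invr_neq0 (qpow_neq0 a))).
  rewrite mulr0 -[RHS]E /omega /=; field; exact: qpow_neq0.
rewrite ltnNge ltad /= in E; apply: (mulfI (qpow_neq0 a)).
rewrite mulr0 -[RHS]E /omega /=; field; exact: qpow_neq0.
Qed.

(** The equation at a, b, b, a, where the terms in A_ab A_ba cancel because a
    nonzero A_ab forces h_a = h_b. *)
Lemma defect_cycle a b : (a < b)%N -> tail_sum A b a a + A a a * A b b = tail_sum A a b b.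
Proof.
move=> ab; have nab : a != b by rewrite -val_eqE /= ltn_eqF.
have nba : b != a by rewrite eq_sym.
have := D0 a b b a.
rewrite /defect (negPf nab) !eqxx !dqpow_diag !dqpow_off // ab ltnNge (ltnW ab) => E.
have A0 : (qpow par q b - qpow par q a) * A a b = 0.
  have [->|/par_even_qpow ->] := eqVneq (A a b) 0; first by rewrite mulr0.
  by rewrite subrr mul0r.
apply/eqP; rewrite -subr_eq0; apply/eqP; apply: (mulfI (omega_neq0 b)).
rewrite mulr0 -[RHS]E /= mul1r mulr1 A0; ring.
Qed.

Lemma normal_form_of_defect : normal_form A.
Proof.
split; [exact: defect_order | exact: defect_chain | | | exact: defect_cycle].
- move=> a d b Ad ad; rewrite leq_eqVlt (leq_eqVlt d) => ab db.
  have := defect_max0 Ad ad; case/orP: ab => [/eqP/val_inj ab|ab].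
    rewrite -ab in db *.
    case/orP: db => [/eqP/val_inj da|db]; first by case/eqP: ad.
    by rewrite ltnNge (ltnW db).
  case/orP: db => [/eqP/val_inj db|db]; first by rewrite db ab.
  move=> _; have := @defect_offdiag a d b Ad ad.
  rewrite -!val_eqE /= ltn_eqF // gtn_eqF // ab !ltnNge (ltnW ab) (ltnW db) /=.
  move=> /(_ isT isT) <-.
  by ring.
- move=> a d b Ad ad; rewrite leq_eqVlt (leq_eqVlt b d) => ba bd.
  have := defect_max0 Ad ad; case/orP: ba => [/eqP/val_inj ba|ba].
    rewrite ba in bd *; case/orP: bd => [/eqP/val_inj bd|bd]; first by case/eqP: ad.
    by rewrite bd => ->; rewrite addr0.
  case/orP: bd => [/eqP/val_inj bd|bd].
    by rewrite -bd ltnNge (ltnW ba) /= => ->; rewrite add0r.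
  move=> _; have := @defect_offdiag a d b Ad ad.
  rewrite -!val_eqE /= gtn_eqF // ltn_eqF // ba bd !ltnNge (ltnW ba) /= => /(_ isT isT) E.
  by apply/eqP; rewrite eq_sym -subr_eq0 -[X in _ == X]E; apply/eqP; ring.
Qed.

End OfDefect.

End Normal.

(** * From the normal form to the entry equations *)

Section ToDefect.

Variables (F : fieldType) (N : nat) (par : 'I_N -> bool) (q : F).

Implicit Types (a b c d e : 'I_N).
Variable A : 'M[F]_N.
Hypotheses (q0 : q != 0) (evA : par_even par A) (nf : normal_form A).

Lemma nf_chain0 a e d : a != e -> e != d -> a != d -> A a e * A e d = 0.
Proof.
move=> ae ed ad; have [->|Ae] := eqVneq (A a e) 0; first by rewrite mul0r.
have [->|Ed] := eqVneq (A e d) 0; first by rewrite mulr0.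
by rewrite (nf_chain nf Ae Ed) ?eqxx in ad.
Qed.

Lemma nf_order0 a b c d : b != c -> a != d ->
  ((a < b)%N%:R - (c < d)%N%:R) * (A b c * A a d) = 0 :> F.
Proof.
move=> bc ad; have [->|Bc] := eqVneq (A b c) 0; first by rewrite mul0r mulr0.
have [->|Ad] := eqVneq (A a d) 0; first by rewrite !mulr0.
by rewrite (nf_order nf Bc Ad) // subrr mul0r.
Qed.

Lemma nf_row0 a c d : a != c -> a != d -> c != d -> A a c * A a d = 0.
Proof.
move=> ac ad cd; have := nf_order0 ac ad; have := nf_order0 ad ac.
rewrite ltnn; case: (ltngtP c d) => [_|_|/val_inj /eqP]; last by rewrite (negPf cd).
  by move=> _ /eqP; rewrite sub0r mulN1r oppr_eq0 => /eqP.
by move=> /eqP; rewrite sub0r mulN1r oppr_eq0 mulrC => /eqP.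
Qed.

Lemma nf_col0 a b c : a != c -> b != c -> a != b -> A a c * A b c = 0.
Proof.
move=> ac bc ab; have := nf_order0 ac bc; have := nf_order0 bc ac.
rewrite ltnn; case: (ltngtP a b) => [_|_|/val_inj /eqP]; last by rewrite (negPf ab).
  by move=> /eqP; rewrite subr0 mul1r mulrC => /eqP.
by move=> _ /eqP; rewrite subr0 mul1r => /eqP.
Qed.

Lemma nf_hi0 a d b : a != d -> (a <= b)%N -> (d <= b)%N -> A b b * A a d = 0.
Proof.
move=> ad ab db; have [->|Ad] := eqVneq (A a d) 0; first by rewrite mulr0.
by rewrite (nf_hi nf Ad) // mul0r.
Qed.

Lemma nf_lo0 a d b : a != d -> (b <= a)%N -> (b <= d)%N ->
  A b b * A a d = (A a a + A d d) * A a d.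
Proof.
move=> ad ba bd; have [->|Ad] := eqVneq (A a d) 0; first by rewrite !mulr0.
by rewrite (nf_lo nf Ad ad ba bd).
Qed.

Lemma nf_tail b a d : a != d ->
  tail_sum A b a d = (b < a)%N%:R * (A a a * A a d) + (b < d)%N%:R * (A d d * A a d).
Proof.
move=> ad; rewrite tail_sum_off // => [|e ae ed]; last exact: nf_chain0.
by rewrite mulrDl !mulrA.
Qed.

(** The equation at a, b, b, d reduces to this identity.  If b lies between a
    and d or beyond both, each term is zero by [nf_hi0]; if b lies below both,
    they cancel by [nf_lo0]. *)
Lemma nf_offdiag a d b : a != d -> a != b -> b != d ->
  ((a < b)%N%:R - (b < d)%N%:R) * (A b b * A a d) + tail_sum A b a d = 0.
Proof.
move=> ad; rewrite nf_tail // -!val_eqE /=.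
case: (ltngtP a b) => //= ab _; case: (ltngtP b d) => //= bd _.
- by rewrite (@nf_hi0 a d d) ?(ltnW (ltn_trans ab bd)) //; ring.
- by rewrite nf_hi0 ?(ltnW ab) ?(ltnW bd) //; ring.
- by rewrite nf_lo0 ?(ltnW ab) ?(ltnW bd) //; ring.
- by rewrite (@nf_hi0 a d a) ?(ltnW (ltn_trans bd ab)) //; ring.
Qed.

Lemma nf_cycle0 a b : a != b ->
  ((a < b)%N%:R - (b < a)%N%:R) * (A a a * A b b)
  + tail_sum A b a a - tail_sum A a b b = 0.
Proof.
rewrite -val_eqE /=; case: (ltngtP a b) => //= ab _.
  by rewrite -(nf_diag nf ab); ring.
by rewrite -(nf_diag nf ab); ring.
Qed.

Lemma nf_max0 a d : a != d -> (d < a)%N%:R * (A a a * A a d) = 0 :> F.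
Proof. by move=> ad; case: ltnP => da; rewrite ?mul0r // nf_hi0 ?mulr0 ?(ltnW da). Qed.

Lemma nf_max0' a d : a != d -> (a < d)%N%:R * (A d d * A a d) = 0 :> F.
Proof. by move=> ad; case: ltnP => da; rewrite ?mul0r // nf_hi0 ?mulr0 ?(ltnW da). Qed.

Lemma even_qpow0 a b : (qpow par q a - qpow par q b) * A a b = 0.
Proof.
have [->|/(par_even_qpow q evA) ->] := eqVneq (A a b) 0; first by rewrite mulr0.
by rewrite subrr mul0r.
Qed.

Lemma nf_tail_row a d : a != d -> tail_sum A a a d = 0.
Proof. by move=> ad; rewrite nf_tail // ltnn nf_max0' // mul0r addr0. Qed.

Lemma nf_tail_col a b : b != a -> tail_sum A a b a = 0.
Proof. by move=> ba; rewrite nf_tail // ltnn nf_max0 // mul0r addr0. Qed.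

(** In each pattern of coincidences among a, b, c, d the defect is a combination
    of the products that the preceding lemmas show to be zero. *)
Lemma defect_of_normal_form a b c d : defect par q A a b c d = 0.
Proof.
have h0 := qpow_neq0 par q0; rewrite /defect.
have [<-|ac] := eqVneq a c.
  have [<-|ad] := eqVneq a d.
    have [<-|ab] := eqVneq a b; first by rewrite !dqpow_diag; ring.
    have ba : b != a by rewrite eq_sym.
    rewrite !dqpow_diag !dqpow_off // nf_tail_col // ltnn /omega /=.
    transitivity ((1 - qpow par q a ^+ 2) * ((1 - (a < b)%N%:R) * (A a a * A b a))).
      by field.
    have := nf_max0' ba; rewrite -!val_eqE /= in ab ba *.
    case: (ltngtP a b) ab => //= _ _; first by rewrite subrr mul0r mulr0.
    by rewrite mul1r subr0 mul1r => ->; rewrite mulr0.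
  have da : d != a by rewrite eq_sym.
  have [<-|ab] := eqVneq a b.
    rewrite !dqpow_diag !dqpow_off // nf_tail_row // ltnn /omega /=.
    transitivity ((qpow par q a ^+ 2 - 1) * ((1 - (a < d)%N%:R) * (A a a * A a d))).
      by field.
    have := nf_max0 ad; rewrite -!val_eqE /= in ad da *.
    case: (ltngtP a d) ad => //= _ _; first by rewrite subrr mul0r mulr0.
    by rewrite mul1r subr0 mul1r => ->; rewrite mulr0.
  have ba : b != a by rewrite eq_sym.
  rewrite dqpow_diag !dqpow_off //=.
  have [<-|bd] := eqVneq b d; first by ring.
  have C0 := nf_chain0 ba ad bd.
  transitivity (omega par q a * qpow par q a
      * ((a < b)%N%:R - (a < d)%N%:R) * (A b a * A a d)
    + omega par q a ^+ 2 * (((a < b)%N%:R - (a < d)%N%:R) * tail_sum A a b d));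
    first by ring.
  rewrite C0 nf_tail // mulr0 add0r.
  suff -> : ((a < b)%N%:R - (a < d)%N%:R) * ((a < b)%N%:R * (A b b * A b d) +
    (a < d)%N%:R * (A d d * A b d)) = 0 :> F by rewrite mulr0.
  rewrite -!val_eqE /= in ab ad.
  case: (ltngtP a b) ab => //= lab _; case: (ltngtP a d) ad => //= lad _; try by ring.
    by rewrite (@nf_hi0 b d b) ?(ltnW (ltn_trans lad lab)) //; ring.
  by rewrite (@nf_hi0 b d d) ?(ltnW (ltn_trans lab lad)) //; ring.
have ca : c != a by rewrite eq_sym.
have [bc|bc] := eqVneq b c.
  rewrite -{c}bc in ac ca *; rename ac into ab, ca into ba.
  have [<-|ad] := eqVneq a d.
    rewrite !dqpow_diag !dqpow_off //=.
    transitivity (- ((qpow par q a - qpow par q b) * A a b) * A b a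
      + omega par q b * (((a < b)%N%:R - (b < a)%N%:R) * (A a a * A b b)
       + tail_sum A b a a - tail_sum A a b b)); first by ring.
    by rewrite even_qpow0 nf_cycle0 // oppr0 mul0r mulr0 addr0.
  have [<-|bd] := eqVneq b d.
    rewrite !dqpow_diag !dqpow_off //= nf_tail_col // ltnn /=.
    transitivity (omega par q b * ((a < b)%N%:R * (A b b * A a b))); first by ring.
    by rewrite nf_max0' // mulr0.
  have db : d != b by rewrite eq_sym.
  rewrite !dqpow_diag !dqpow_off //=.
  transitivity ((qpow par q b - 1) * (A a b * A b d)
      + omega par q b * (((a < b)%N%:R - (b < d)%N%:R) * (A b b * A a d)
       + tail_sum A b a d)); first by ring.
  by rewrite nf_chain0 // nf_offdiag // !mulr0 addr0.
have cb : c != b by rewrite eq_sym.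
have [<-|ad] := eqVneq a d.
  have [<-|ab] := eqVneq a b.
    rewrite dqpow_diag !dqpow_off //= (nf_tail_row ac) ?ltnn /=.
    transitivity (- omega par q c * ((c < a)%N%:R * (A a a * A a c))); first by ring.
    by rewrite nf_max0 // mulr0.
  have ba : b != a by rewrite eq_sym.
  rewrite !dqpow_diag !dqpow_off //=.
  transitivity ((1 - qpow par q a) * (A b a * A a c)
    - omega par q c * (((b < a)%N%:R - (a < c)%N%:R) * (A a a * A b c)
                       + tail_sum A a b c)).
    rewrite -!val_eqE /= in ab ac.
    by case: (ltngtP a b) ab => // _ _; case: (ltngtP a c) ac => // _ _ /=; ring.
  by rewrite nf_chain0 // nf_offdiag // !mulr0 subr0.
have [<-|ab] := eqVneq a b.
  have [<-|cd] := eqVneq c d.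
    rewrite !dqpow_diag !dqpow_off //= !ltnn /=.
    transitivity ((qpow par q a - qpow par q c) * A a c * A a c); first by ring.
    by rewrite even_qpow0 mul0r.
  have dc : d != c by rewrite eq_sym.
  rewrite !dqpow_diag !dqpow_off //= !ltnn /=.
  transitivity ((qpow par q a - 1 - omega par q c * (c < d)%N%:R) * (A a c * A a d));
    first by ring.
  by rewrite nf_row0 // mulr0.
have [<-|cd] := eqVneq c d.
  rewrite !dqpow_diag !dqpow_off //= !ltnn /=.
  transitivity ((1 - qpow par q c + omega par q c * (a < b)%N%:R) * (A a c * A b c));
    first by ring.
  by rewrite nf_col0 // mulr0.
have dc : d != c by rewrite eq_sym.
rewrite !dqpow_off //=.
transitivity (omega par q c * (((a < b)%N%:R - (c < d)%N%:R) * (A b c * A a d)));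
  first by ring.
by rewrite nf_order0 // mulr0.
Qed.

End ToDefect.

(** * Normal forms as partial permutations *)

Section NormalData.

Variables (F : fieldType) (N : nat) (par : 'I_N -> bool).

Implicit Types (a b c d e i j : 'I_N) (A : 'M[F]_N).

Section Data.

Variables (Y : {set 'I_N}) (sigma : 'I_N -> 'I_N) (x y : 'I_N -> F).

Definition data_mx : 'M[F]_N :=
  \sum_(i < N) x i *: delta_mx i i + \sum_(j in Y) y j *: delta_mx (sigma j) j.

(** If every chain j -> sigma j -> sigma (sigma j) of arcs returns to j, this is
    y_j y_(sigma j) on the 2-cycles of sigma and 0 elsewhere. *)
Definition cycle_prod j : F :=
  if (j \in Y) && (sigma j \in Y) then y j * y (sigma j) else 0.

(** [normal_form] for A = [data_mx], in terms of the partial permutation and the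
    coefficients. *)
Record normal_data : Prop := NormalData {
  nd_adm : admissible par Y sigma;
  nd_neq0 : forall j, j \in Y -> y j != 0;
  nd_inv : forall j, j \in Y -> sigma j \in Y -> sigma (sigma j) = j;
  nd_hi : forall j b, j \in Y -> (j <= b)%N -> (sigma j <= b)%N -> x b = 0;
  nd_lo : forall j b, j \in Y -> (b <= j)%N -> (b <= sigma j)%N ->
    x b = x j + x (sigma j);
  nd_diag : forall a b, (a < b)%N ->
    (b < sigma a)%N%:R * cycle_prod a + x a * x b =
    x b ^+ 2 + (a < sigma b)%N%:R * cycle_prod b }.

Lemma data_mxE i j :
  data_mx i j = (if i == j then x i else 0)
                + (if (j \in Y) && (sigma j == i) then y j else 0).
Proof.
rewrite /data_mx mxE !summxE; congr (_ + _).
  rewrite (bigD1 i) //= big1 ?addr0 => [|k ki]; rewrite !mxE ?eqxx /=.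
    by rewrite eq_sym; case: (_ == _); rewrite ?mulr1 ?mulr0.
  by rewrite eq_sym (negPf ki) mulr0.
rewrite big_mkcond (bigD1 j) //= big1 ?addr0 => [|k kj]; rewrite !mxE ?eqxx.
  by rewrite eq_sym andbT; case: (_ \in _); case: (_ == _); rewrite ?mulr1 ?mulr0.
by rewrite (eq_sym j) (negPf kj) andbF mulr0 if_same.
Qed.

Hypothesis nofix : {in Y, forall i, sigma i != i}.

Lemma data_mx_diag i : data_mx i i = x i.
Proof.
rewrite data_mxE eqxx; case: ifP => [/andP[iY /eqP si]|]; rewrite ?addr0 //.
by have := nofix iY; rewrite si eqxx.
Qed.

Lemma data_mx_off i j : i != j ->
  data_mx i j = if (j \in Y) && (sigma j == i) then y j else 0.
Proof. by move=> ij; rewrite data_mxE (negPf ij) add0r. Qed.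

Lemma data_mx_neq0 i j : i != j -> data_mx i j != 0 -> j \in Y /\ sigma j = i.
Proof.
by move=> ij; rewrite data_mx_off //; case: ifP => [/andP[jY /eqP ->]|]; rewrite ?eqxx.
Qed.

(** A diagonal entry of A A collects the square of the diagonal entry of A and,
    if j is on a 2-cycle, the product along that cycle. *)
Lemma tail_sum_data b j : (forall j, j \in Y -> sigma j \in Y -> sigma (sigma j) = j) ->
  tail_sum data_mx b j j = (b < j)%N%:R * x j ^+ 2 + (b < sigma j)%N%:R * cycle_prod j.
Proof.
move=> inv; rewrite /tail_sum big_mkcond (bigD1 j) //=; congr (_ + _).
  by rewrite data_mx_diag; case: (b < j)%N; rewrite ?mul1r ?mul0r ?expr2.
rewrite /cycle_prod; have [jY|jY] /= := boolP (j \in Y); last first.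
  rewrite mulr0 big1 // => e ej; rewrite (data_mx_off ej) (negPf jY) mulr0.
  by rewrite if_same.
have sj := nofix jY; rewrite (bigD1 (sigma j)) //= big1 ?addr0; last first.
  move=> e /andP[ej es]; rewrite (data_mx_off ej) (eq_sym _ e) (negPf es) andbF mulr0.
  by rewrite if_same.
rewrite data_mx_off 1?eq_sym // data_mx_off // jY eqxx /=.
have [sY|sY] /= := boolP (sigma j \in Y).
  by rewrite inv // eqxx [y j * _]mulrC; case: (b < _)%N; rewrite ?mul1r ?mul0r.
by rewrite mul0r mulr0 if_same.
Qed.

End Data.

Lemma normal_form_of_data Y sigma x y : normal_data Y sigma x y ->
  par_even par (data_mx Y sigma x y) /\ normal_form (data_mx Y sigma x y).
Proof.
move=> nd; case: (nd_adm nd) => dec par_sigma nofix.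
have off i j := @data_mx_neq0 Y sigma x y i j.
have diag := data_mx_diag x y nofix.
split=> [i j|]; first have [->|ij] := eqVneq i j; rewrite //.
  by case/(off _ _ ij) => jY <-; rewrite par_sigma.
split.
- move=> a b c d bc ad nbc nad.
  have [cY sc] := off _ _ nbc bc; have [dY sd] := off _ _ nad ad.
  have := dec c d cY dY; have := dec d c dY cY; rewrite sc sd /idx !ltnS.
  case: (ltngtP c d) => [cd _ /(_ isT) //|cd /(_ isT) ba _|/val_inj cd _ _].
    by rewrite ltnNge (ltnW ba).
  by rewrite -sc -sd cd ltnn.
- move=> a e d ae ed nae ned.
  have [eY se] := off _ _ nae ae; have [dY sd] := off _ _ ned ed.
  by rewrite -se -sd (nd_inv nd) // sd.
- move=> a d b ad nad ab db; have [dY sd] := off _ _ nad ad.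
  by rewrite diag (nd_hi nd dY) // sd.
- move=> a d b ad nad ab db; have [dY sd] := off _ _ nad ad.
  by rewrite !diag (nd_lo nd dY) // ?sd // addrC.
- move=> a b ab; rewrite !(tail_sum_data _ _ nofix _ _ (nd_inv nd)) !diag ab.
  by rewrite ltnNge (ltnW ab) mul0r add0r mul1r; exact: (nd_diag nd ab).
Qed.

(** Y consists of the columns with a nonzero off-diagonal entry, whose row is
    unique by [nf_order]. *)
Lemma data_of_normal_form A : par_even par A -> normal_form A ->
  exists (Y : {set 'I_N}) (sigma : 'I_N -> 'I_N) (x y : 'I_N -> F),
    A = data_mx Y sigma x y /\ normal_data Y sigma x y.
Proof.
move=> evA nf.
pose Y := [set j | [exists i, (i != j) && (A i j != 0)]].
(* The default j makes sigma the identity off Y. *)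
pose sigma j := odflt j [pick i | (i != j) && (A i j != 0)].
pose x i := A i i; pose y j := A (sigma j) j.
have sP j : j \in Y -> sigma j != j /\ A (sigma j) j != 0.
  rewrite inE /sigma => /existsP[i ij]; case: pickP => [k /andP[]|/(_ i)] //=.
  by rewrite ij.
have sU i j : i != j -> A i j != 0 -> j \in Y /\ sigma j = i.
  move=> ij Aij; have jY : j \in Y by rewrite inE; apply/existsP; exists i; rewrite ij.
  have [sj As] := sP j jY; split=> //; apply: ord_inj.
  case: (ltngtP (sigma j) i) => // lt.
    by have := nf_order nf Aij As ij sj; rewrite ltnn lt.
  by have := nf_order nf As Aij sj ij; rewrite ltnn lt.
have nofix : {in Y, forall i, sigma i != i} by move=> i /sP[].
have AE : A = data_mx Y sigma x y.
  apply/matrixP => i j; have [->|ij] := eqVneq i j; first by rewrite data_mx_diag.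
  rewrite data_mx_off //; case: ifP => [/andP[jY /eqP <-] //|].
  have [//|/(sU _ _ ij)[-> ->]] := eqVneq (A i j) 0.
  by rewrite eqxx.
have inv j : j \in Y -> sigma j \in Y -> sigma (sigma j) = j.
  move=> jY sY; have [sj Aj] := sP _ jY; have [ssj As] := sP _ sY.
  exact: (nf_chain nf As Aj).
exists Y, sigma, x, y; split=> //; split=> //.
- split=> // [i j iY jY|i iY]; first rewrite /idx !ltnS => ij.
    have [si Ai] := sP _ iY; have [sj Aj] := sP _ jY.
    by rewrite -(nf_order nf Ai Aj).
  by have [_ /evA] := sP _ iY.
- by move=> j /sP[].
- by move=> j b /sP[sj Aj] jb sb; apply: (nf_hi nf Aj).
- by move=> j b /sP[sj Aj] jb sb; rewrite addrC; apply: (nf_lo nf Aj).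
- move=> a b ab; have := nf_diag nf ab; rewrite AE !tail_sum_data // !data_mx_diag // ab.
  by rewrite ltnNge (ltnW ab) mul0r add0r mul1r.
Qed.

End NormalData.

(** * The numbers b_- and b_+ *)

Section Bounds.

Variables (N : nat) (par : 'I_N -> bool).
Variables (Y : {set 'I_N}) (sigma : 'I_N -> 'I_N).
Hypothesis adm : admissible par Y sigma.

Lemma bminus_lt n : (0 < n)%N ->
  (forall j, j \in Y -> ((minn j (sigma j)).+1 < n)%N) -> (bminus Y sigma < n)%N.
Proof.
move=> n0 lo; apply: (big_ind (fun k => k < n)%N) => [//|k l kn ln|i].
  by rewrite gtn_max kn.
rewrite !inE => /orP[/andP[iY lt]|/imsetP[j]].
  have le : (i < sigma i)%N by [].
  by have := lo _ iY; rewrite /minn le.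
rewrite !inE => /andP[jY lt] ->; have le : (sigma j <= j)%N by apply: ltnW.
by have := lo _ jY; rewrite /minn [(j < _)%N]ltnNge le.
Qed.

Lemma bplus_gt n : (n < N.+1)%N ->
  (forall j, j \in Y -> (n < (maxn j (sigma j)).+1)%N) -> (n < bplus Y sigma)%N.
Proof.
move=> nN hi; apply: (big_ind (fun k => n < k)%N) => [//|k l kn ln|i].
  by rewrite leq_min kn.
rewrite !inE => /orP[/andP[iY lt]|/imsetP[j]].
  have le : (sigma i <= i)%N by apply: ltnW.
  by have := hi _ iY; rewrite /maxn [(i < _)%N]ltnNge le.
rewrite !inE => /andP[jY lt] ->; have le : (j < sigma j)%N by [].
by have := hi _ jY; rewrite /maxn le.
Qed.

Lemma bigmin_le (I : eqType) (r : seq I) (P : pred I) (f : I -> nat) n i :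
  i \in r -> P i -> (\big[minn/n]_(k <- r | P k) f k <= f i)%N.
Proof.
move=> + Pi; elim: r => // k r IH; rewrite inE big_cons => /predU1P[<-|/IH le].
  by rewrite Pi geq_minl.
by case: ifP => // _; rewrite geq_min le orbT.
Qed.

Lemma leq_bminus j : j \in Y -> ((minn j (sigma j)).+1 <= bminus Y sigma)%N.
Proof.
case: adm => _ _ nofix jY; rewrite /bminus /minn; case: (ltnP j (sigma j)) => lt.
  by apply: (@leq_bigmax_cond _ _ (@idx N) j); rewrite !inE jY /idx ltnS lt.
apply: (@leq_bigmax_cond _ _ (@idx N) (sigma j)); rewrite inE.
apply/orP; right; apply: imset_f.
by rewrite inE jY /idx ltnS ltn_neqAle lt andbT val_eqE nofix.
Qed.

Lemma geq_bplus j : j \in Y -> (bplus Y sigma <= (maxn j (sigma j)).+1)%N.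
Proof.
case: adm => _ _ nofix jY; rewrite /bplus /maxn; case: (ltnP j (sigma j)) => lt.
  apply: (@bigmin_le _ _ _ (@idx N) _ (sigma j)); rewrite ?mem_index_enum // inE.
  by apply/orP; right; apply: imset_f; rewrite inE jY /idx ltnS lt.
apply: (@bigmin_le _ _ _ (@idx N) _ j); rewrite ?mem_index_enum // !inE jY /idx ltnS.
by rewrite ltn_neqAle lt andbT val_eqE nofix.
Qed.

(** This is what gives b_- < b_+.  For j < k the point j lies below k, and for
    k < j the point sigma j lies below sigma k. *)
Lemma min_lt_max j k : j \in Y -> k \in Y -> (minn j (sigma j) < maxn k (sigma k))%N.
Proof.
case: adm => dec _ nofix jY kY.
have := dec j k jY kY; have := dec k j kY jY; rewrite /idx.
have : sigma k != k :> nat by rewrite val_eqE nofix.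
have [/val_inj ->|/eqP] := eqVneq (val j) (val k); rewrite /=; lia.
Qed.

Lemma bminus_lt_bplus : (bminus Y sigma < bplus Y sigma)%N.
Proof.
apply: bplus_gt => [|k kY]; apply: bminus_lt => // j jY.
  by rewrite ltnS gtn_min ltn_ord.
by rewrite ltnS min_lt_max.
Qed.

End Bounds.

(** * Type 2: no 2-cycles *)

Section Classification.

Variables (F : fieldType) (N : nat) (par : 'I_N -> bool).
Variables (Y : {set 'I_N}) (sigma : 'I_N -> 'I_N) (x y : 'I_N -> F).

(** As Y and sigma(Y) are disjoint there are no 2-cycles, and the quadratic
    condition on the diagonal is that of a step function. *)
Lemma normal_data_of_type2 :
  type2 par Y sigma x y -> normal_data par Y sigma x y.
Proof.
case=> adm [disj [b [lam [/andP[b_lo b_hi] xlo xhi y0]]]].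
have nocyc j : j \in Y -> sigma j \in Y -> False.
  move=> jY sY; have : sigma j \in Y :&: sigma @: Y by rewrite inE sY imset_f.
  by rewrite disj inE.
have z0 j : cycle_prod Y sigma y j = 0.
  by rewrite /cycle_prod; case: ifP => // /andP[jY /(nocyc _ jY)].
(* Ordinals count from 0, so that i lies in [1, b] iff i < b. *)
have lo j : j \in Y -> (minn j (sigma j) < b)%N.
  by move=> jY; have := leq_bminus adm jY; lia.
have hi j : j \in Y -> (b <= maxn j (sigma j))%N.
  by move=> jY; have := geq_bplus adm jY; lia.
have xlam (i : 'I_N) : (i < b)%N -> x i = lam by move=> ib; apply: xlo.
have x0 (i : 'I_N) : (b <= i)%N -> x i = 0.
  by move=> ib; apply: xhi; rewrite /idx ltnS ib ltn_ord.
split=> // [j jY /(nocyc _ jY) //|j i jY ji si|j i jY ij si|a c ac].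
- by rewrite x0 //; have := hi j jY; lia.
- have := lo j jY; have := hi j jY; rewrite /minn /maxn.
  case: ltnP => _ bs sb; rewrite [x i]xlam; try lia.
    by rewrite xlam // x0 // addr0.
  by rewrite x0 // xlam // add0r.
- rewrite !z0 !mulr0 add0r addr0.
  have [cb|bc] := ltnP c b; last by rewrite (x0 c) // expr2 !mulr0.
  by rewrite (xlam a (ltn_trans ac cb)) xlam // expr2.
Qed.

(** Without 2-cycles the quadratic condition is x_a x_b = x_b^2 for a < b, so
    all entries before the last nonzero one are equal to it.  The step lies in
    [b_-, b_+) by [nd_lo] and [nd_hi]; if x = 0, any point of that interval can
    serve as the step. *)
Lemma type2_of_normal_data : normal_data par Y sigma x y ->
  (forall j, j \in Y -> sigma j \notin Y) -> type2 par Y sigma x y.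
Proof.
move=> nd nocyc; have adm := nd_adm nd.
have z0 j : cycle_prod Y sigma y j = 0.
  by rewrite /cycle_prod; case: ifP => // /andP[/nocyc/negPf ->].
split=> //; split.
  apply/setP => i; rewrite !inE; apply/negP => /andP[iY /imsetP[j jY ij]].
  by have := nocyc j jY; rewrite -ij iY.
have [/existsP[i0 xi0]|/existsPn x0] := boolP [exists i, x i != 0]; last first.
  exists (bminus Y sigma), 0; split; first by rewrite leqnn (bminus_lt_bplus adm).
  - by move=> i _; have := x0 i; rewrite negbK => /eqP.
  - by move=> i _; have := x0 i; rewrite negbK => /eqP.
  - exact: (nd_neq0 nd).
case: (@arg_maxnP _ i0 (fun i => x i != 0) (fun i => i) xi0) => b xb bmax.
have x0 (i : 'I_N) : (b < i)%N -> x i = 0.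
  by move=> bi; apply/eqP; apply: contraTT bi => /bmax; rewrite -leqNgt.
exists b.+1, (x b); split.
- apply/andP; split.
    rewrite -ltnS; apply: (bminus_lt (sigma := sigma)) => // j jY.
    rewrite !ltnS leqNgt; apply/negP; rewrite leq_min => /andP[bj bs]; case/eqP: xb.
    by rewrite (nd_lo nd jY) ?(ltnW bj) ?(ltnW bs) // !x0 // addr0.
  apply: bplus_gt => [|j jY]; first by rewrite ltnS ltn_ord.
  rewrite ltnS ltnNge; apply/negP.
  rewrite geq_max => /andP[jb sb]; case/eqP: xb; exact: (nd_hi nd jY).
- move=> i /andP[_ ib]; have [-> //|ib'] := eqVneq i b.
  have {ib ib'} ib : (i < b)%N by rewrite ltn_neqAle val_eqE ib'.
  have := nd_diag nd ib; rewrite !z0 !mulr0 add0r addr0 expr2; exact: mulIf.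
- by move=> i /andP[bi _]; apply: x0.
- exact: (nd_neq0 nd).
Qed.

(** * Type 1: nested 2-cycles *)

(** The quadratic condition is checked on the blocks on which x is constant.
    The essential case is a <= b_- < b < b_+, where it reads
    - lambda mu + (lambda + mu) lambda = lambda^2; in the others the products
    along the cycles cancel or do not occur. *)
Lemma normal_data_of_type1 :
  type1 par Y sigma x y -> normal_data par Y sigma x y.
Proof.
case=> adm [bm [bp [[bm0 bp0 mp pN] [YE [sE [lam [mu [xlo xmid xhi yy]]]]]]]].
have inY j : (j \in Y) = (j < bm)%N || (bp <= j.+1 <= bp + bm - 1)%N.
  by rewrite YE inE /idx.
have sv j : j \in Y -> (sigma j : nat) = (bp + bm - j.+1).-1.
  by move=> /sE; rewrite /idx => <-.
have sY j : j \in Y -> sigma j \in Y.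
  by move=> jY; have := jY; rewrite !inY sv // => H; lia.
have inv j : j \in Y -> sigma (sigma j) = j.
  by move=> jY; apply: ord_inj; rewrite !sv ?sY //; move: jY; rewrite inY; lia.
have zE j : cycle_prod Y sigma y j = if j \in Y then - (lam * mu) else 0.
  rewrite /cycle_prod; have [jY|] //= := boolP (j \in Y); rewrite sY //.
  by have [] := yy j jY.
have xl (i : 'I_N) : (i < bm)%N -> x i = lam + mu by move=> ib; apply: xlo.
have xm (i : 'I_N) : (bm <= i)%N -> (i.+1 < bp)%N -> x i = lam.
  by move=> bi ib; apply: xmid; rewrite /idx ltnS bi.
have xh (i : 'I_N) : (bp <= i.+1)%N -> x i = 0.
  by move=> bi; apply: xhi; rewrite /idx bi ltn_ord.
split=> // [j jY|j jY _|j i jY ji si|j i jY ij si|a b ab].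
- by have [E nz] := yy j jY; apply: contraNneq nz => y0; rewrite -E y0 mul0r.
- exact: inv.
- have sj := sv j jY; rewrite inY in jY.
  by apply: xh; lia.
- have sj := sv j jY; rewrite inY in jY.
  have [jb|bj] := ltnP j bm.
    have ib : (i < bm)%N by lia.
    have sb : (bp <= (sigma j).+1)%N by lia.
    by rewrite (xl i ib) (xl j jb) (xh _ sb) addr0.
  have ib : (i < bm)%N by lia.
  have jb : (bp <= j.+1)%N by lia.
  have sb : (sigma j < bm)%N by lia.
  by rewrite (xl i ib) (xh j jb) (xl _ sb) add0r.
rewrite !zE; have [a1|a1] := ltnP a bm.
  have aY : a \in Y by rewrite inY a1.
  have sa := sv a aY; rewrite aY (xl a a1).
  have [b1|b1] := ltnP b bm.
    have bY : b \in Y by rewrite inY b1.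
    have sb := sv b bY; rewrite bY xl //.
    have -> : (b < sigma a)%N by lia.
    have -> : (a < sigma b)%N by lia.
    by ring.
  have [b2|b2] := ltnP b.+1 bp.
    have -> : (b < sigma a)%N by lia.
    have /negPf -> : b \notin Y by rewrite inY; lia.
    by rewrite xm //=; ring.
  rewrite xh //; have [b3|b3] := leqP b.+1 (bp + bm - 1).
    have bY : b \in Y by rewrite inY b2 b3 orbT.
    have sb := sv b bY; rewrite bY.
    have -> : (b < sigma a)%N = (a < sigma b)%N by lia.
    by ring.
  have -> : (b < sigma a)%N = false by lia.
  have /negPf -> : b \notin Y by rewrite inY; lia.
  by rewrite /=; ring.
have E (j k : 'I_N) : (bm <= j)%N -> (bm <= k)%N ->
  (j < sigma k)%N%:R * (if k \in Y then - (lam * mu) else 0) = 0.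
  move=> jb kb; case: ifP => [kY|_]; last by rewrite mulr0.
  have sk := sv k kY; rewrite inY in kY.
  have -> : (j < sigma k)%N = false by lia.
  by rewrite mul0r.
have b1 := leq_trans a1 (ltnW ab); rewrite !E // add0r addr0.
have [b2|b2] := ltnP b.+1 bp; last by rewrite (xh b) //; ring.
by rewrite !xm ?expr2 //; lia.
Qed.

End Classification.

Section DecreasingReflection.

Variables (N : nat) (sigma : 'I_N -> 'I_N) (C : pred 'I_N) (m o : 'I_N).
Implicit Types i j : 'I_N.

Hypotheses (decr : forall i j, C i -> C j -> (i < j)%N -> (sigma j < sigma i)%N)
  (inv : forall i, C i -> sigma (sigma i) = i) (o0 : o = 0%N :> nat)
  (low : forall i, (i <= m)%N -> C i)
  (high : forall j, (sigma m <= j)%N -> (j <= sigma o)%N -> C j).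

(** A strictly decreasing map to the integers gains at least 1 in each step. *)
Lemma decreasing_gain_below k i : (i + k = m)%N -> (sigma m + k <= sigma i)%N.
Proof.
elim: k i => [|k IH] i ik.
  have -> : i = m by apply: ord_inj; rewrite -ik addn0.
  by rewrite addn0.
have lt : (i.+1 < N)%N.
  by apply: leq_ltn_trans (ltn_ord m); rewrite -ik addnS ltnS leq_addr.
have iS : (Ordinal lt + k = m)%N by rewrite /= addSnnS.
rewrite addnS; apply: leq_ltn_trans (IH _ iS) _.
apply: decr; rewrite //=; apply: low; last by rewrite -iS leq_addr.
by rewrite -ik leq_addr.
Qed.

Lemma decreasing_gain_above k j :
  j = (sigma m + k)%N :> nat -> (j <= sigma o)%N -> (sigma j + k <= m)%N.
Proof.
elim: k j => [|k IH] j jk jo.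
  have -> : j = sigma m by apply: ord_inj; rewrite jk addn0.
  by rewrite addn0 inv ?low.
have lt : (sigma m + k < N)%N.
  by apply: leq_ltn_trans (ltn_ord j); rewrite jk leq_add2l.
have jo' : (sigma m + k <= sigma o)%N.
  by apply: leq_trans jo; rewrite jk leq_add2l.
rewrite addnS -addSn; apply: leq_trans (IH (Ordinal lt) erefl jo').
rewrite leq_add2r; apply: decr; last by rewrite jk /= addnS.
  by apply: high; rewrite /= ?leq_addr.
by apply: high; rewrite // jk leq_addr.
Qed.

(** By strict decrease sigma i is at least sigma m + (m - i); the same estimate
    at sigma i, which sigma maps back to i, bounds it from above. *)
Lemma decreasing_reflection_low i :
  (i <= m)%N -> sigma i = (sigma m + (m - i))%N :> nat.
Proof.
move=> im; have lo : (sigma m + (m - i) <= sigma i)%N.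
  by apply: decreasing_gain_below; rewrite subnKC.
have io : (sigma i <= sigma o)%N.
  have [->//|io] := eqVneq i o; apply: ltnW; apply: decr; rewrite ?low ?o0 //.
  by rewrite lt0n -o0 val_eqE.
have hi : (sigma (sigma i) + (sigma i - sigma m) <= m)%N.
  apply: decreasing_gain_above => //; rewrite subnKC //.
  by apply: leq_trans lo; apply: leq_addr.
by rewrite inv ?low // in hi; lia.
Qed.

Lemma decreasing_reflection_high j :
  (sigma m <= j)%N -> (j <= sigma m + m)%N -> sigma j = (sigma m + m - j)%N :> nat.
Proof.
move=> mj jm; have so : sigma o = (sigma m + m)%N :> nat.
  by rewrite decreasing_reflection_low ?o0 ?subn0.
have jo : (j <= sigma o)%N by rewrite so.
have hi : (sigma j + (j - sigma m) <= m)%N.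
  by apply: decreasing_gain_above; rewrite // subnKC.
have sm : (sigma j <= m)%N by apply: leq_trans hi; apply: leq_addr.
have := decreasing_reflection_low sm; rewrite inv ?high //; lia.
Qed.

End DecreasingReflection.

Section Cycles.

Variables (F : fieldType) (N : nat) (par : 'I_N -> bool).
Variables (Y : {set 'I_N}) (sigma : 'I_N -> 'I_N) (x y : 'I_N -> F).
Hypothesis nd : normal_data par Y sigma x y.

Implicit Types (a b i j : 'I_N).

Definition in_cycle j := (j \in Y) && (sigma j \in Y).

Let z := cycle_prod Y sigma y.

Lemma in_cycle_inv j : in_cycle j -> sigma (sigma j) = j.
Proof. by case/andP; apply: (nd_inv nd). Qed.

Lemma in_cycle_sigma j : in_cycle j -> in_cycle (sigma j).
Proof. by move=> cj; rewrite /in_cycle in_cycle_inv // andbC. Qed.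

Lemma cycle_prod_sigma j : in_cycle j -> z (sigma j) = z j.
Proof.
move=> cj; have := in_cycle_sigma cj; rewrite /z /cycle_prod -!/(in_cycle _) cj => ->.
by rewrite in_cycle_inv // mulrC.
Qed.

Lemma cycle_prod_neq0 j : (z j != 0) = in_cycle j.
Proof.
rewrite /z /cycle_prod -/(in_cycle j); case: ifP => [/andP[jY sY]|]; rewrite ?eqxx //.
by rewrite mulf_neq0 ?(nd_neq0 nd).
Qed.

Lemma normal_data_decr i j :
  i \in Y -> j \in Y -> (i < j)%N -> (sigma j < sigma i)%N.
Proof. by have [dec _ _] := nd_adm nd; apply: dec. Qed.

(** The quadratic condition where x_b vanishes; it carries 2-cycles from one of
    a, b to the other. *)
Lemma cycle_diag a b : (a < b)%N -> x b = 0 ->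
  (b < sigma a)%N%:R * z a = (a < sigma b)%N%:R * z b.
Proof.
by move=> ab xb; have := nd_diag nd ab; rewrite xb mulr0 expr2 mul0r addr0 add0r.
Qed.

Lemma innermost_cycle : (exists2 j, j \in Y & sigma j \in Y) ->
  exists m, [/\ in_cycle m, (m < sigma m)%N &
    forall j, in_cycle j -> (j < sigma j)%N -> (j <= m)%N].
Proof.
move=> [j0 jY sY]; have c0 : in_cycle j0 by rewrite /in_cycle jY.
have [j1 j1P] : exists j, in_cycle j && (j < sigma j)%N.
  have [_ _ nofix] := nd_adm nd; have := nofix j0 jY.
  rewrite neq_ltn => /orP[lt|lt]; last by exists j0; rewrite c0.
  by exists (sigma j0); rewrite in_cycle_sigma ?in_cycle_inv.
case: (@arg_maxnP _ j1 (fun j => in_cycle j && (j < sigma j)%N) (fun j => j) j1P).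
move=> m /andP[cm mM] mmax; exists m; split=> // j cj lt.
by apply: mmax; rewrite cj.
Qed.

Section Innermost.

Variable m : 'I_N.
Hypotheses (cm : in_cycle m) (mM : (m < sigma m)%N).
Hypothesis mmax : forall j, in_cycle j -> (j < sigma j)%N -> (j <= m)%N.

Let o : 'I_N := Ordinal (leq_ltn_trans (leq0n m) (ltn_ord m)).

Let mY : m \in Y. Proof. by case/andP: cm. Qed.

Lemma diag_above b : (sigma m <= b)%N -> x b = 0.
Proof.
by move=> Mb; apply: (nd_hi nd mY) => //; apply: leq_trans Mb; apply: ltnW.
Qed.

Lemma diag_below b : (b <= m)%N -> x b = x m.
Proof.
move=> bm; rewrite (nd_lo nd mY bm (leq_trans bm (ltnW mM))).
by rewrite (diag_above (leqnn _)) addr0.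
Qed.

(** [cycle_diag] for a and sigma m transports z from m to a. *)
Lemma cycle_below a : (a <= m)%N -> in_cycle a /\ z a = z m.
Proof.
have [->//|am] := eqVneq a m.
move=> le; have {le am} lt : (a < m)%N by rewrite ltn_neqAle val_eqE am.
have := cycle_diag (ltn_trans lt mM) (diag_above (leqnn _)).
have := cm; rewrite -cycle_prod_neq0 => zm.
rewrite in_cycle_inv // lt mul1r cycle_prod_sigma //; case: ltnP => [Ms|_].
  by rewrite mul1r => za; rewrite -cycle_prod_neq0 za.
by rewrite mul0r => /esym/eqP; rewrite (negPf zm).
Qed.

(** [cycle_diag] for o and b: the product z_o is nonzero, hence so is z_b. *)
Lemma cycle_above b : (sigma m <= b)%N -> (b <= sigma o)%N -> in_cycle b.
Proof.
have [co zo] := cycle_below (leq0n m : o <= m)%N.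
move=> Mb; have [-> _|bo] := eqVneq b (sigma o); first exact: in_cycle_sigma.
move=> le; have {le bo} lt : (b < sigma o)%N by rewrite ltn_neqAle val_eqE bo.
have ob : (o < b)%N by apply: leq_trans Mb; apply: leq_ltn_trans mM.
have := cycle_diag ob (diag_above Mb); rewrite lt mul1r => E.
rewrite -cycle_prod_neq0; apply: contraTneq co => zb.
by rewrite -cycle_prod_neq0 E zb mulr0 eqxx.
Qed.

Let low i : (i <= m)%N -> in_cycle i. Proof. by case/cycle_below. Qed.

Let decr i j : in_cycle i -> in_cycle j -> (i < j)%N -> (sigma j < sigma i)%N.
Proof. by case/andP=> iY _ /andP[jY _]; apply: normal_data_decr. Qed.

Lemma sigma_below i : (i <= m)%N -> sigma i = (sigma m + (m - i))%N :> nat.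
Proof.
exact: (@decreasing_reflection_low _ _ in_cycle m o decr in_cycle_inv erefl
  low cycle_above).
Qed.

Lemma sigma_above j : (sigma m <= j)%N -> (j <= sigma m + m)%N ->
  sigma j = (sigma m + m - j)%N :> nat.
Proof.
exact: (@decreasing_reflection_high _ _ in_cycle m o decr in_cycle_inv erefl
  low cycle_above).
Qed.

Lemma top_index_lt : (sigma m + m < N)%N.
Proof. by have := ltn_ord (sigma o); rewrite sigma_below //= subn0. Qed.

(** Let k be the smaller endpoint of an arc outside the 2-cycles.  It lies
    strictly between m and sigma m, so x_k = x_m by [nd_lo], and then the
    quadratic condition for m and k leaves z_m = 0. *)
Lemma all_in_cycle j : j \in Y -> in_cycle j.
Proof.
move=> jY; apply/negP => /negP ncj.
have nsj : ~~ in_cycle (sigma j).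
  by apply: contra ncj; rewrite /in_cycle jY => /andP[].
have [k [nck xk kmin]] : exists k : 'I_N, [/\ ~~ in_cycle k,
    x k = x j + x (sigma j) & k = minn j (sigma j) :> nat].
  rewrite /minn; case: (ltnP j (sigma j)) => [js|sj].
    by exists j; split=> //; apply: (nd_lo nd jY) => //; apply: ltnW.
  by exists (sigma j); split=> //; apply: (nd_lo nd jY).
have mk : (m < k)%N by rewrite ltnNge; apply: contra nck => /low.
have kM : (k < sigma m)%N.
  by have := min_lt_max (nd_adm nd) jY mY; rewrite -kmin (maxn_idPr (ltnW mM)).
have xkm : x k = x m.
  rewrite -(diag_below (leq0n m : o <= m)%N) xk.
  by apply/esym; apply: (nd_lo nd jY).
have zk : z k = 0 by apply/eqP; apply: contraNT nck; rewrite -cycle_prod_neq0.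
have := nd_diag nd mk; rewrite -/z kM zk xkm mul1r mulr0 addr0 expr2.
move=> /eqP; rewrite addrC -subr_eq0 addrAC subrr add0r.
by apply/negP; rewrite cycle_prod_neq0.
Qed.

Lemma mem_cycles j : (j \in Y) = (j <= m)%N || (sigma m <= j <= sigma m + m)%N.
Proof.
apply/idP/idP => [jY|/orP[/low/andP[]|/andP[Mj jM]]] //; last first.
  have /andP[] // : in_cycle j.
  by apply: cycle_above; rewrite // sigma_below //= subn0.
have cj := all_in_cycle jY; have [_ _ nofix] := nd_adm nd.
have := nofix j jY; rewrite neq_ltn => /orP[lt|lt]; last by rewrite mmax.
have sm : (sigma j <= m)%N by apply: mmax; rewrite ?in_cycle_inv ?in_cycle_sigma.
have := sigma_below sm; rewrite in_cycle_inv // => ->.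
by rewrite leq_addr leq_add2l leq_subr orbT.
Qed.

Lemma cycle_prodE j : j \in Y -> z j = z m.
Proof.
move=> jY; have cj := all_in_cycle jY; move: jY; rewrite mem_cycles.
case/orP=> [/cycle_below[]//|/andP[Mj jM]].
have [|_ <-] := @cycle_below (sigma j); last by rewrite cycle_prod_sigma.
by rewrite sigma_above // leq_subLR addnC [X in (X <= _)%N]addnC leq_add2r.
Qed.

Lemma cycle_prod_between b : (m < b)%N -> (b < sigma m)%N -> z b = 0.
Proof.
move=> mb bM; apply/eqP; apply: contraT; rewrite cycle_prod_neq0 => /andP[+ _].
by rewrite mem_cycles leqNgt mb leqNgt bM.
Qed.

Lemma diag_between b : (m < b)%N -> (b < sigma m)%N ->
  x b ^+ 2 = x m * x b + z m.
Proof.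
move=> mb bM; have := nd_diag nd mb.
by rewrite -/z (cycle_prod_between mb bM) bM mul1r mulr0 addr0 addrC => ->.
Qed.

(** x_b is nonzero, since otherwise [diag_between] gives z_m = 0; so it cancels
    in x_a x_b = x_b^2. *)
Lemma diag_between_eq a b : (m < a)%N -> (a < b)%N -> (b < sigma m)%N -> x a = x b.
Proof.
move=> ma ab bM; have mb := ltn_trans ma ab; have := nd_diag nd ab; rewrite -/z.
rewrite (cycle_prod_between ma (ltn_trans ab bM)) (cycle_prod_between mb bM).
rewrite !mulr0 add0r addr0 expr2; apply: mulIf; apply: contraTneq cm => xb.
have := diag_between mb bM.
by rewrite -cycle_prod_neq0 xb mulr0 add0r expr2 mul0r => <-; rewrite eqxx.
Qed.

Hypothesis root : forall p u : F, exists l, l ^+ 2 = p * l + u.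

(** If nothing lies strictly between m and sigma m, lambda is only constrained
    by the quadratic equation, whence the assumption that it has a root. *)
Lemma middle_value : exists lam, lam ^+ 2 = x m * lam + z m /\
  forall b, (m < b)%N -> (b < sigma m)%N -> x b = lam.
Proof.
have [/existsP[b /andP[mb bM]]|/existsPn no] :=
  boolP [exists b : 'I_N, (m < b)%N && (b < sigma m)%N]; last first.
  have [l lE] := root (x m) (z m); exists l; split=> // b mb bM.
  by have := no b; rewrite mb bM.
exists (x b); split; first exact: diag_between.
move=> c mc cM; case: (ltngtP c b) => [cb|bc|/val_inj -> //].
  exact: diag_between_eq.
by rewrite (@diag_between_eq b c).
Qed.

Lemma type1_of_innermost : type1 par Y sigma x y.
Proof.
have [lam [lamE lamx]] := middle_value.
have uE : - (lam * (x m - lam)) = z m.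
  by rewrite mulrBr opprB -expr2 lamE mulrC addrAC subrr add0r.
split; first exact: (nd_adm nd).
(* The successors pass from ordinals, counted from 0, to elements of [1, N]. *)
exists m.+1, (sigma m).+1; split; first split=> //.
  by rewrite addn1 addSn !ltnS addnC addSn top_index_lt.
split.
  apply/setP => j; rewrite inE mem_cycles /idx; move: (j : nat) (sigma m : nat) => k M.
  clear; lia.
split.
  move=> j jY; move: (jY); rewrite mem_cycles => /orP[jm|/andP[Mj jM]].
    by rewrite /idx sigma_below //; clear - jm; lia.
  by rewrite /idx sigma_above //; clear - jM; lia.
exists lam, (x m - lam); split=> [i|i|i|j jY]; rewrite /idx ?ltnS.
- by move=> /andP[_ im]; rewrite addrC subrK diag_below.
- by move=> /andP[mi iM]; apply: lamx.
- by move=> /andP[Mi _]; apply: diag_above.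
- rewrite uE cycle_prod_neq0; split=> //.
  by rewrite -(cycle_prodE jY) /z /cycle_prod -/(in_cycle j) all_in_cycle.
Qed.

End Innermost.

Lemma type1_of_normal_data : (forall p u : F, exists l, l ^+ 2 = p * l + u) ->
  (exists2 j, j \in Y & sigma j \in Y) -> type1 par Y sigma x y.
Proof.
move=> root /innermost_cycle[m [cm mM mmax]].
exact: (type1_of_innermost cm mM mmax root).
Qed.

End Cycles.

(** * The classification *)

(** The absence or presence of 2-cycles separates the two types. *)
Lemma normal_data_iff_types (F : closedFieldType) (N : nat) (par : 'I_N -> bool)
    (Y : {set 'I_N}) (sigma : 'I_N -> 'I_N) (x y : 'I_N -> F) :
  normal_data par Y sigma x y <->
  type1 par Y sigma x y \/ type2 par Y sigma x y.
Proof.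
split=> [nd|[/normal_data_of_type1|/normal_data_of_type2] //].
have [/exists_inP[j jY sY]|/exists_inPn nocyc] :=
  boolP [exists j in Y, sigma j \in Y]; [left|right].
- apply: (type1_of_normal_data nd); last by exists j.
  move=> p u; pose cs i := if i == 0%N then u else p.
  have [l lE] := @GRing.solve_monicpoly F 2 cs isT.
  by exists l; rewrite lE !big_ord_recl big_ord0 /= expr0 expr1 mulr1 addr0 addrC.
- exact: type2_of_normal_data nd nocyc.
Qed.

Lemma reflection_classification (F : closedFieldType) (N : nat)
    (par : 'I_N -> bool) (q : F) (A : 'M[F]_N) :
  q != 0 -> q != 1 -> q != -1 -> regular_parameter par q ->
  reflection_eq par q A <->
  exists (Y : {set 'I_N}) (sigma : 'I_N -> 'I_N) (x y : 'I_N -> F),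
    A = data_mx Y sigma x y /\
    (type1 par Y sigma x y \/ type2 par Y sigma x y).
Proof.
move=> q0 q1 qN1 qreg; split=> [AE|[Y [sigma [x [y [-> types]]]]]].
  have evA := reflection_par_even q0 qreg AE.
  have D0 := (reflection_defect q evA).1 AE.
  have nf := normal_form_of_defect q0 q1 qN1 evA D0.
  have [Y [sigma [x [y [AY nd]]]]] := data_of_normal_form evA nf.
  by exists Y, sigma, x, y; split=> //; apply/normal_data_iff_types.
have [ev nf] := normal_form_of_data ((normal_data_iff_types _ _ _ _ _).2 types).
by apply/(reflection_defect q ev) => a b c d; apply: defect_of_normal_form.
Qed.

Theorem theorem3p2 (R : realType) (N : nat) (hN : (1 <= N)%N)
    (par : 'I_N -> bool) (q : complex R)
    (hq0 : q != 0) (hq1 : q != 1) (hqN1 : q != -1)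
    (hqi : regular_parameter par q) (A : 'M[complex R]_N) :
  reflection_eq par q A <->
  exists (Y : {set 'I_N}) (sigma : 'I_N -> 'I_N) (x y : 'I_N -> complex R),
    A = \sum_(i < N) x i *: delta_mx i i
        + \sum_(j in Y) y j *: delta_mx (sigma j) j
    /\ (type1 par Y sigma x y \/ type2 par Y sigma x y).
Proof. exact: reflection_classification. Qed.
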